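(* Let $m,n\ge 1$, let $\Phi\in L^\infty(\mathbb{T},\mathcal{L}(\mathbb{C}^m,\mathbb{C}^m))$, and let $\{G_i\}_{i=1}^n$ and $\{H_i\}_{i=1}^n$ be orthonormal sets in $H^2_{\mathbb{C}^m}(\mathbb{D})$. Define $T_n:H^2_{\mathbb{C}^m}(\mathbb{D})\to H^2_{\mathbb{C}^m}(\mathbb{D})$ by $T_n(F)=T_\Phi(F)+\sum_{i=1}^n\langle F,G_i\rangle H_i$. Suppose $\Phi=0$ almost everywhere on $\mathbb{T}$. Then the subspace $\operatorname{Ker}T_n$ is nearly $S^*$-invariant with defect $n$, and the defect space is $\mathcal{F}=\bigvee\{G_1,G_2,\ldots,G_n\}$.
   Context: $\mathbb{D}$ is the open unit disc and $\mathbb{T}$ the unit circle. $H^2_{\mathbb{C}^m}(\mathbb{D})$ is the $\mathbb{C}^m$-valued Hardy space, identified via radial boundary values with a closed subspace of $L^2(\mathbb{T},\mathbb{C}^m)$; $P_m$ is the orthogonal projection of $L^2(\mathbb{T},\mathbb{C}^m)$ onto $H^2_{\mathbb{C}^m}(\mathbb{D})$. For $\Phi\in L^\infty(\mathbb{T},\mathcal{L}(\mathbb{C}^m,\mathbb{C}^m))$ the Toeplitz operator is $T_\Phi F=P_m(\Phi F)$, $F\in H^2_{\mathbb{C}^m}(\mathbb{D})$. $S$ is the forward shift $SF(z)=zF(z)$ on $H^2_{\mathbb{C}^m}(\mathbb{D})$ and $S^*$ is its adjoint, the backward shift $S^*F(z)=(F(z)-F(0))/z$. $\bigvee$ denotes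 the (closed) linear span. A closed subspace $\mathcal{M}\subset H^2_{\mathbb{C}^m}(\mathbb{D})$ is nearly $S^*$-invariant with defect $p$ if there is a $p$-dimensional subspace $\mathcal{F}\subset H^2_{\mathbb{C}^m}(\mathbb{D})$ (which may be taken to be orthogonal to $\mathcal{M}$) such that $F\in\mathcal{M}$ and $F(0)=0$ imply $S^*F\in\mathcal{M}\oplus\mathcal{F}$; such an $\mathcal{F}$ is called the defect space. *)

(* Defs.v *)
From HB Require Import structures.
From mathcomp Require Import all_boot all_order all_algebra.
From mathcomp Require Import all_classical all_reals all_analysis.
From mathcomp Require Import complex ring lra.

Set Implicit Arguments.
Unset Strict Implicit.
Unset Printing Implicit Defensive.

Import Order.TTheory GRing.Theory Num.Theory.
Import numFieldNormedType.Exports.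

Local Open Scope classical_set_scope.
Local Open Scope ring_scope.
Local Open Scope complex_scope.

(* The usual topology of the complex numbers: R[i] normed over itself. *)
HB.instance Definition _ (R : realType) := NormedModule.copy R[i] (R[i]^o).

Definition vdot (R : realType) (m : nat) (u v : 'cV[R[i]]_m) : R[i] :=
  \sum_(i < m) u i 0 * (v i 0)^*.

Definition vnormsq (R : realType) (m : nat) (u : 'cV[R[i]]_m) : R :=
  complex.Re (vdot u u).

Definition vnorm (R : realType) (m : nat) (u : 'cV[R[i]]_m) : R :=
  Num.sqrt (vnormsq u).

Definition disc (R : realType) := {z : R[i] | `|z| < 1}.

Lemma disc0_subproof (R : realType) : `|0 : R[i]| < 1.
Proof. by rewrite normr0 ltr01. Qed.

Definition disc0 (R : realType) : disc R := exist _ 0 (disc0_subproof R).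

Definition circle (R : realType) := {z : R[i] | `|z| == 1}.

Lemma expi_subproof (R : realType) (t : R) : `|cos t +i* sin t| == 1.
Proof. by rewrite normc_def /= cos2Dsin2 sqrtr1. Qed.

Definition expi (R : realType) (t : R) : circle R :=
  exist _ (cos t +i* sin t) (expi_subproof t).

(* The point r z of the disc; the default value is irrelevant for 0 <= r < 1. *)
Definition radial (R : realType) (r : R) (z : circle R) : disc R :=
  insubd (disc0 R) (r%:C * val z).

Definition sqsummable (R : realType) (m : nat) (A : nat -> 'cV[R[i]]_m) : Prop :=
  cvgn (series (fun k => vnormsq (A k))).

Definition has_expansion (R : realType) (m : nat)
    (F : disc R -> 'cV[R[i]]_m) (A : nat -> 'cV[R[i]]_m) : Prop :=
  forall (z : disc R) (i : 'I_m),
    series (fun k => val z ^+ k * A k i 0) @ \oo --> F z i 0.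

Definition hardy_pred (R : realType) (m : nat) : pred (disc R -> 'cV[R[i]]_m) :=
  fun F => `[< exists A, sqsummable A /\ has_expansion F A >].

Lemma normsqD_le (R : realType) (x y : R[i]) :
  complex.Re ((x + y) * (x + y)^*) <=
    2 * (complex.Re (x * x^*) + complex.Re (y * y^*)).
Proof.
case: x y => [a b] [c d] /=; rewrite -subr_ge0.
rewrite (_ : _ - _ = (a - c) ^+ 2 + (b - d) ^+ 2); last by ring.
by rewrite addr_ge0 ?sqr_ge0.
Qed.

Lemma vnormsqE (R : realType) (m : nat) (u : 'cV[R[i]]_m) :
  vnormsq u = \sum_(i < m) complex.Re (u i 0 * (u i 0)^*).
Proof. by rewrite /vnormsq /vdot raddf_sum. Qed.

Lemma vnormsq_ge0 (R : realType) (m : nat) (u : 'cV[R[i]]_m) : 0 <= vnormsq u.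
Proof.
rewrite vnormsqE sumr_ge0// => i _; case: (u i 0) => a b /=.
by rewrite mulrN opprK -!expr2 addr_ge0 ?sqr_ge0.
Qed.

Lemma vnormsqD_le (R : realType) (m : nat) (u v : 'cV[R[i]]_m) :
  vnormsq (u + v) <= 2 * (vnormsq u + vnormsq v).
Proof.
rewrite !vnormsqE -big_split/= mulr_sumr ler_sum// => i _.
by rewrite mxE normsqD_le.
Qed.

Lemma vnormsqZ (R : realType) (m : nat) (a : R[i]) (u : 'cV[R[i]]_m) :
  vnormsq (a *: u) = complex.Re (a * a^*) * vnormsq u.
Proof.
rewrite !vnormsqE mulr_sumr; apply: eq_bigr => i _; rewrite mxE.
by case: a (u i 0) => [a b] [c d] /=; ring.
Qed.

Lemma hardy_submod_closed (R : realType) (m : nat) :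
  submod_closed (@hardy_pred R m).
Proof.
split.
  apply/asboolP; exists (fun=> 0); split.
    rewrite /sqsummable (_ : series _ = fun=> 0); first exact: is_cvg_cst.
    apply/funext => n; rewrite /series/= big1// => k _.
    by rewrite vnormsqE big1// => i _; rewrite mxE mul0r.
  move=> z i; rewrite (_ : series _ = fun=> 0) ?mxE; first exact: cvg_cst.
  by apply/funext => n; rewrite /series/= big1// => k _ /=; rewrite ?mxE mulr0.
move=> a F G /asboolP[A [sA FA]] /asboolP[B [sB GB]]; apply/asboolP.
exists (fun k => a *: A k + B k); split.
  pose c := complex.Re (a * a^*).
  apply: (@series_le_cvg _ _
    (fun k => 2 * (c * vnormsq (A k) + vnormsq (B k)))).
  - by move=> k; exact: vnormsq_ge0.
  - move=> k; rewrite mulr_ge0// addr_ge0 ?vnormsq_ge0//.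
    by rewrite -vnormsqZ vnormsq_ge0.
  - by move=> k; rewrite -vnormsqZ vnormsqD_le.
  - apply: is_cvg_seriesZ; apply: is_cvg_seriesD => //.
    exact: is_cvg_seriesZ.
move=> z i.
have -> : series (fun k => val z ^+ k * (a *: A k + B k) i 0) =
    (fun n => a * series (fun k => val z ^+ k * A k i 0) n
      + series (fun k => val z ^+ k * B k i 0) n).
  apply/funext => n; rewrite /series/= mulr_sumr -big_split/=.
  by apply: eq_bigr => k _; rewrite !mxE mulrDr mulrCA.
have -> : (a *: F + G) z i 0 = a * F z i 0 + G z i 0 by rewrite !mxE.
by apply: cvgD (GB z i); apply: cvgM (cvg_cst a) (FA z i).
Qed.

HB.instance Definition _ (R : realType) (m : nat) :=
  GRing.isSubmodClosed.Build R[i] (disc R -> 'cV[R[i]]_m) (@hardy_pred R m)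
    (hardy_submod_closed R m).

(* The Hardy space of the disc: the functions F(z) = \sum_k z^k A_k with
   \sum_k |A_k|^2 finite. *)
Record hardy (R : realType) (m : nat) := Hardy {
  hardy_fun :> disc R -> 'cV[R[i]]_m ;
  _ : hardy_fun \in @hardy_pred R m }.

HB.instance Definition _ (R : realType) (m : nat) :=
  [isSub for @hardy_fun R m].
HB.instance Definition _ (R : realType) (m : nat) :=
  [Choice of hardy R m by <:].
HB.instance Definition _ (R : realType) (m : nat) :=
  [SubChoice_isSubLmodule of hardy R m by <:].

(* The Taylor coefficients of F at 0, which are unique. *)
Definition hardy_coef (R : realType) (m : nat) (F : hardy R m) : nat -> 'cV[R[i]]_m :=
  xget (fun=> 0) [set A | has_expansion F A].

Definition hdot (R : realType) (m : nat) (F G : hardy R m) : R[i] :=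
  limn (series (fun k => vdot (hardy_coef F k) (hardy_coef G k))).

Definition hnorm (R : realType) (m : nat) (F : hardy R m) : R :=
  Num.sqrt (complex.Re (hdot F F)).

(* The unit circle carries normalised arc length: its functions are handled
   through t |-> f (e^(i t)) on [0, 2 pi]. *)
Definition angles (R : realType) : set R := `[0, 2 * pi]%classic.

Definition circle_ae (R : realType) (P : circle R -> Prop) : Prop :=
  {ae @lebesgue_measure R, forall t, angles t -> P (expi t)}.

Definition circle_measurable (R : realType) (f : circle R -> R[i]) : Prop :=
  measurable_fun (@angles R) (fun t => complex.Re (f (expi t))) /\
  measurable_fun (@angles R) (fun t => complex.Im (f (expi t))).

Definition circle_int (R : realType) (f : circle R -> R[i]) : R[i] :=
  ((2 * pi)^-1 * Rintegral lebesgue_measure (@angles R)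
                   (fun t => complex.Re (f (expi t)))) +i*
  ((2 * pi)^-1 * Rintegral lebesgue_measure (@angles R)
                   (fun t => complex.Im (f (expi t)))).

Definition L2 (R : realType) (m : nat) (f : circle R -> 'cV[R[i]]_m) : Prop :=
  (forall i, circle_measurable (fun z => f z i 0)) /\
  (\int[lebesgue_measure]_(t in @angles R) (vnormsq (f (expi t)))%:E < +oo)%E.

Definition L2dot (R : realType) (m : nat) (f g : circle R -> 'cV[R[i]]_m) : R[i] :=
  circle_int (fun z => vdot (f z) (g z)).

Definition Linfty (R : realType) (m : nat) (Phi : circle R -> 'M[R[i]]_m) : Prop :=
  (forall i j, circle_measurable (fun z => Phi z i j)) /\
  exists C : R, circle_ae (fun z =>
    forall v : 'cV[R[i]]_m, vnorm (Phi z *m v) <= C * vnorm v).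

(* f represents, in L^2 of the circle, the radial boundary values of F; by
   Fatou's theorem every F has such an f, unique up to null sets. *)
Definition boundary_values (R : realType) (m : nat) (F : hardy R m)
    (f : circle R -> 'cV[R[i]]_m) : Prop :=
  L2 f /\ circle_ae (fun z =>
    forall i : 'I_m, F (radial r z) i 0 @[r --> 1^'-] --> f z i 0).

Definition boundary (R : realType) (m : nat) (F : hardy R m) :
    circle R -> 'cV[R[i]]_m :=
  xget (fun=> 0) [set f | boundary_values F f].

(* The orthogonal projection of L^2 onto the closed subspace of boundary values
   of functions in the Hardy space. *)
Definition hardy_proj (R : realType) (m : nat) (f : circle R -> 'cV[R[i]]_m) :
    hardy R m :=
  xget 0 [set K | exists2 k, boundary_values K k &
    forall (E : hardy R m) (e : circle R -> 'cV[R[i]]_m),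
      boundary_values E e -> L2dot (f - k) e = 0].

Definition toeplitz (R : realType) (m : nat) (Phi : circle R -> 'M[R[i]]_m)
    (F : hardy R m) : hardy R m :=
  hardy_proj (fun z => Phi z *m boundary F z).

Definition perturbed_toeplitz (R : realType) (m n : nat)
    (Phi : circle R -> 'M[R[i]]_m) (G H : 'I_n -> hardy R m)
    (F : hardy R m) : hardy R m :=
  toeplitz Phi F + \sum_(i < n) hdot F (G i) *: H i.

(* (F(z) - F(0)) / z: the unique K with z K(z) = F(z) - F(0) on the whole disc,
   so that the value at z = 0 is that of the analytic extension. *)
Definition backward_shift (R : realType) (m : nat) (F : hardy R m) : hardy R m :=
  xget 0 [set K : hardy R m |
    forall z : disc R, val z *: K z = F z - F (disc0 R)].

Definition hardy_orthonormal (R : realType) (m n : nat) (G : 'I_n -> hardy R m) : Prop :=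
  forall i j, hdot (G i) (G j) = (i == j)%:R.

Definition hardy_subspace (R : realType) (m : nat) (M : set (hardy R m)) : Prop :=
  M 0 /\ forall (a : R[i]) F G, M F -> M G -> M (a *: F + G).

Definition hclosure (R : realType) (m : nat) (M : set (hardy R m)) :
    set (hardy R m) :=
  [set F | forall eps : R, 0 < eps -> exists2 G, M G & hnorm (F - G) < eps].

Definition hclosed (R : realType) (m : nat) (M : set (hardy R m)) : Prop :=
  hclosure M `<=` M.

Definition lin_span (R : realType) (m n : nat) (G : 'I_n -> hardy R m) :
    set (hardy R m) :=
  [set F | exists c : 'I_n -> R[i], F = \sum_(i < n) c i *: G i].

Definition closed_span (R : realType) (m n : nat) (G : 'I_n -> hardy R m) :
    set (hardy R m) :=
  hclosure (lin_span G).

Definition lin_indep (R : realType) (m n : nat) (G : 'I_n -> hardy R m) : Prop :=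
  forall c : 'I_n -> R[i], \sum_(i < n) c i *: G i = 0 -> forall i, c i = 0.

Definition has_dim (R : realType) (m : nat) (V : set (hardy R m)) (p : nat) : Prop :=
  exists2 e : 'I_p -> hardy R m, lin_indep e & V = lin_span e.

Definition hardy_orthogonal (R : realType) (m : nat) (M V : set (hardy R m)) : Prop :=
  forall F G, M F -> V G -> hdot F G = 0.

(* The orthogonality of M and V makes the sum M + V an orthogonal direct sum. *)
Definition defect_space (R : realType) (m : nat) (M : set (hardy R m)) (p : nat)
    (V : set (hardy R m)) : Prop :=
  [/\ has_dim V p, hardy_orthogonal M V &
      forall F, M F -> F (disc0 R) = 0 ->
        exists A B, [/\ M A, V B & backward_shift F = A + B]].

Definition nearly_invariant_with_defect (R : realType) (m : nat)
    (M : set (hardy R m)) (p : nat) : Prop :=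
  [/\ hardy_subspace M, hclosed M & exists V, defect_space M p V].

Definition kernel_of (R : realType) (m : nat) (T : hardy R m -> hardy R m) :
    set (hardy R m) :=
  [set F | T F = 0].

(* Main.v *)
Require Import Defs.
From mathcomp Require Import all_boot all_order all_algebra.
From mathcomp Require Import all_classical all_reals all_analysis.
From mathcomp Require Import measurable_realfun complex ring lra.

(** Every [F] is the sum of [F - P F] and [P F], where [P F] is the sum of the
    [<F, G_i> G_i], so once the kernel is known to be the orthogonal complement
    of the [G_i] the defect property holds for any vector, [S^* F] included.
    Since the [H_i] are independent, this amounts to [T_Phi = 0]: the
    projection of an almost everywhere null function is a function of the Hardy
    space with null radial limits, and such a function vanishes.  For the last
    point let [a_k] be the Taylor coefficients, [S] the sum of the [|a_k|^2] and
    [p] the Taylor polynomial of order [N].  On the circle [|p|^2] is the almost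
    everywhere limit of [|p - f_s|^2] as [s] tends to 1, where [f_s(z) = f(sz)],
    so Fatou's lemma and Parseval's identity give
    [sum_(k < N) |a_k|^2 <= S - sum_(k < N) |a_k|^2] for all [N], hence [S <= 0]. *)

Set Implicit Arguments.
Unset Strict Implicit.
Unset Printing Implicit Defensive.

Import Order.TTheory GRing.Theory Num.Theory.
Import numFieldNormedType.Exports.
Local Open Scope classical_set_scope.
Local Open Scope ring_scope.
Local Open Scope complex_scope.

(** * Convergence in the complex numbers through real and imaginary parts *)

Section complex_convergence.
Variable R : realType.
Implicit Types (x y : R[i]) (u : nat -> R[i]).

(** The squared modulus as an element of [R]: the norm of [R[i]] takes its values in [R[i]], whereas
    the series and integrals below are real. *)
Definition normsq x : R := complex.Re (x * x^*).

Lemma normsqE x : normsq x = complex.Re x ^+ 2 + complex.Im x ^+ 2.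
Proof. by case: x => a b; rewrite /normsq /=; ring. Qed.

Lemma ReD x y : complex.Re (x + y) = complex.Re x + complex.Re y.
Proof. by case: x y => [? ?] []. Qed.

Lemma ImD x y : complex.Im (x + y) = complex.Im x + complex.Im y.
Proof. by case: x y => [? ?] []. Qed.

Lemma ReB x y : complex.Re (x - y) = complex.Re x - complex.Re y.
Proof. by case: x y => [? ?] []. Qed.

Lemma ImB x y : complex.Im (x - y) = complex.Im x - complex.Im y.
Proof. by case: x y => [? ?] []. Qed.

Lemma Re_sum I (r : seq I) (P : pred I) (f : I -> R[i]) :
  complex.Re (\sum_(i <- r | P i) f i) = \sum_(i <- r | P i) complex.Re (f i).
Proof. by apply: (big_morph _ ReD). Qed.

Lemma Im_sum I (r : seq I) (P : pred I) (f : I -> R[i]) :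
  complex.Im (\sum_(i <- r | P i) f i) = \sum_(i <- r | P i) complex.Im (f i).
Proof. by apply: (big_morph _ ImD). Qed.

Lemma normsq_ge0 x : 0 <= normsq x.
Proof. by rewrite normsqE addr_ge0 ?sqr_ge0. Qed.

Lemma normsq_eq0 x : normsq x = 0 -> x = 0.
Proof.
case: x => a b; rewrite normsqE /= => /eqP.
by rewrite paddr_eq0 ?sqr_ge0// !sqrf_eq0 => /andP[/eqP -> /eqP ->].
Qed.

Lemma norm_ge_Im x : `|complex.Im x|%:C <= `|x|.
Proof.
case: x => a b; rewrite normc_def lecR -sqrtr_sqr ler_sqrt ?addr_ge0 ?sqr_ge0//.
by rewrite lerDr sqr_ge0.
Qed.

Lemma norm_le_ReIm x : `|x| <= (`|complex.Re x| + `|complex.Im x|)%:C.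
Proof.
case: x => a b; rewrite normc_def lecR /= -[leRHS]ger0_norm ?addr_ge0//.
rewrite -sqrtr_sqr ler_sqrt ?sqr_ge0// sqrrD !real_normK ?num_real//.
by rewrite lerD2r lerDl mulrn_wge0// mulr_ge0.
Qed.

(** Both parts are bounded by the modulus, which is at most the sum of their absolute values. Limits
    thus reduce to real ones. *)
Lemma cvg_complexP T (F : set_system T) {FF : Filter F} (f : T -> R[i]) x :
  f t @[t --> F] --> x <->
  (complex.Re (f t) @[t --> F] --> complex.Re x) /\
  (complex.Im (f t) @[t --> F] --> complex.Im x).
Proof.
split.
  move/cvgrPdist_lt => fx; split; apply/cvgrPdist_lt => e e0.
    have /fx : 0 < e%:C by rewrite ltcR.
    apply: filterS => t; rewrite -ReB -ltcR; apply: le_lt_trans.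
    exact: normc_ge_Re.
  have /fx : 0 < e%:C by rewrite ltcR.
  apply: filterS => t; rewrite -ImB -ltcR; apply: le_lt_trans.
  exact: norm_ge_Im.
move=> [/cvgrPdist_lt fr /cvgrPdist_lt fi]; apply/cvgrPdist_lt => -[e e'].
(* A positive element of [R[i]] has null imaginary part, so the radius is a real number [e]. *)
rewrite ltcE /= => /andP[/eqP -> e0].
have e20 : 0 < e / 2 by rewrite divr_gt0.
near=> t; apply: le_lt_trans (norm_le_ReIm _) _; rewrite ltcR ReB ImB.
rewrite [ltRHS](splitr e) ltrD//; near: t; [exact: fr|exact: fi].
Unshelve. all: by end_near. Qed.

Lemma normsq_sub_cvg T (F : set_system T) {FF : Filter F} (f : T -> R[i]) x y :
  f t @[t --> F] --> x ->
  normsq (y - f t) @[t --> F] --> normsq (y - x).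
Proof.
move=> /cvg_complexP[fr fi].
rewrite normsqE ReB ImB; under eq_fun do rewrite normsqE ReB ImB !expr2.
rewrite !expr2.
by apply: cvgD; apply: cvgM; apply: cvgB => //; exact: cvg_cst.
Qed.
End complex_convergence.

(** * Trigonometric integrals and Parseval's identity for polynomials *)

Section trig.
Variable R : realType.
Local Notation mu := (@lebesgue_measure R).

(** Integrability travels with the value because additivity of the integral requires it; the pair is
    stable under finite linear combinations. *)
Definition integral_is (g : R -> R) (v : R) : Prop :=
  mu.-integrable (@angles R) (EFin \o g) /\
  (\int[mu]_(t in @angles R) (g t)%:E = v%:E)%E.

Lemma measurable_angles : measurable (@angles R : set (measurableTypeR R)).
Proof. exact: measurable_itv. Qed.

Lemma integral_isD g1 v1 g2 v2 : integral_is g1 v1 -> integral_is g2 v2 ->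
  integral_is (g1 \+ g2) (v1 + v2).
Proof.
move=> [i1 h1] [i2 h2]; split.
  rewrite (_ : _ \o _ = (EFin \o g1) \+ (EFin \o g2))%E//.
  by apply: integrableD => //; exact: measurable_angles.
by rewrite /= integralD_EFin ?h1 ?h2//; exact: measurable_angles.
Qed.

Lemma integral_isZ c g v : integral_is g v -> integral_is (fun t => c * g t) (c * v).
Proof.
move=> [i h]; split.
  rewrite (_ : _ \o _ = (fun t => c%:E * (EFin \o g) t)%E)//.
  by apply: integrableZl => //; exact: measurable_angles.
rewrite EFinM -h -(integralZl measurable_angles i c).
by apply: eq_integral => t _; rewrite EFinM.
Qed.

Lemma integral_is_sum N (g : nat -> R -> R) (v : nat -> R) :
  (forall k, (k < N)%N -> integral_is (g k) (v k)) ->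
  integral_is (fun t => \sum_(k < N) g k t) (\sum_(k < N) v k).
Proof.
elim: N => [_|N ih h].
  rewrite big_ord0; split; last by under eq_integral do rewrite big_ord0; rewrite integral0.
  rewrite (_ : _ \o _ = cst 0%E); first exact: integrable0.
  by apply/funext => t /=; rewrite big_ord0.
rewrite big_ord_recr /=.
rewrite (_ : (fun t => _) = (fun t => \sum_(k < N) g k t) \+ g N).
  apply: integral_isD; last exact: h.
  by apply: ih => k kN; apply: h; rewrite ltnS ltnW.
by apply/funext => t; rewrite big_ord_recr.
Qed.

(** The fundamental theorem of calculus on [[0, 2 pi]]; the derivability of [F] supplies its
    continuity at the endpoints. *)
Lemma continuous_integral_is (f F : R -> R) :
  (forall x : R, is_derive x (1 : R) F (f x)) -> continuous f ->
  integral_is f (F (2 * pi) - F 0).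
Proof.
move=> dF cf.
have c (f' : R -> R) : continuous f' -> {within (@angles R), continuous f'}.
  exact: continuous_subspaceT.
have cF : continuous F.
  move=> x; apply/differentiable_continuous/derivable1_diffP.
  exact: (@ex_derive _ _ _ _ _ _ _ (dF x)).
have pi0 : (0 < 2 * pi :> R) by rewrite mulr_gt0// pi_gt0.
split.
  apply: continuous_compact_integrable; first exact: segment_compact.
  exact: c.
rewrite EFinB; apply: continuous_FTC2 => //; first exact: c.
- split; first by move=> x _; exact: (@ex_derive _ _ _ _ _ _ _ (dF x)).
  + by apply: cvg_at_right_filter; exact: cF.
  + by apply: cvg_at_left_filter; exact: cF.
- by move=> x _; rewrite derive1E (@derive_val _ _ _ _ _ _ _ (dF x)).
Qed.

Lemma cos_natpi (k : nat) : cos (k%:R * (2 * pi)) = 1 :> R.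
Proof.
elim: k => [|k ih]; first by rewrite mul0r cos0.
by rewrite -natr1 mulrDl mul1r [X in _ + X]mulr_natl cosD2pi.
Qed.

Lemma sin_natpi (k : nat) : sin (k%:R * (2 * pi)) = 0 :> R.
Proof.
elim: k => [|k ih]; first by rewrite mul0r sin0.
by rewrite -natr1 mulrDl mul1r [X in _ + X]mulr_natl sinD2pi.
Qed.

Lemma cos_diff_pi (k l : nat) : cos ((k%:R - l%:R) * (2 * pi)) = 1 :> R.
Proof. by rewrite mulrBl cosB !cos_natpi !sin_natpi; ring. Qed.

Lemma sin_diff_pi (k l : nat) : sin ((k%:R - l%:R) * (2 * pi)) = 0 :> R.
Proof. by rewrite mulrBl sinB !cos_natpi !sin_natpi; ring. Qed.

Lemma continuous_wcos (w : R) : continuous (fun t => cos (w * t)).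
Proof.
move=> x; apply: (@continuous_comp _ _ _ (fun t => w * t) cos); last exact: continuous_cos.
by apply: cvgM; [exact: cvg_cst|exact: cvg_id].
Qed.

Lemma continuous_wsin (w : R) : continuous (fun t => sin (w * t)).
Proof.
move=> x; apply: (@continuous_comp _ _ _ (fun t => w * t) sin); last exact: continuous_sin.
by apply: cvgM; [exact: cvg_cst|exact: cvg_id].
Qed.

(** For [k != l] the primitive [w^-1 * sin (w * t)] has equal values at both ends, the frequency [w]
    being a nonzero integer. For [k = l] the integrand is 1. *)
Lemma integral_is_cos (k l : nat) :
  integral_is (fun t => cos ((k%:R - l%:R) * t)) (2 * pi * (k == l)%:R).
Proof.
case: (eqVneq k l) => [->|kl].
  rewrite subrr mulr1.
  have := @continuous_integral_is (fun t => cos (0 * t)) id.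
  rewrite subr0; apply; last exact: continuous_wcos.
  by move=> x; rewrite mul0r cos0; exact: is_derive_id.
set w : R := k%:R - l%:R.
have w0 : w != 0 by rewrite subr_eq0 eqr_nat.
have := @continuous_integral_is (fun t => cos (w * t)) (fun t => w^-1 * sin (w * t)).
rewrite sin_diff_pi !mulr0 sin0 mulr0 subrr; apply; last exact: continuous_wcos.
move=> x; apply: is_derive_eq; rewrite -![_ *: _]/(_ * _) ?mulr1 ?mulr0 ?addr0.
by field.
Qed.

Lemma integral_is_sin (k l : nat) :
  integral_is (fun t => sin ((k%:R - l%:R) * t)) 0.
Proof.
case: (eqVneq k l) => [->|kl].
  rewrite subrr.
  have := @continuous_integral_is (fun t => sin (0 * t)) (fun=> 0).
  rewrite subrr; apply; last exact: continuous_wsin.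
  by move=> x; rewrite mul0r sin0; exact: is_derive_cst.
set w : R := k%:R - l%:R.
have w0 : w != 0 by rewrite subr_eq0 eqr_nat.
have := @continuous_integral_is (fun t => sin (w * t)) (fun t => - w^-1 * cos (w * t)).
rewrite cos_diff_pi mulr0 cos0 subrr; apply; last exact: continuous_wsin.
move=> x; apply: is_derive_eq; rewrite -![_ *: _]/(_ * _) ?mulr1 ?mulr0 ?addr0.
by field.
Qed.

Lemma expiX (t : R) k : val (expi t) ^+ k = cos (k%:R * t) +i* sin (k%:R * t).
Proof.
elim: k => [|k ih]; first by rewrite expr0 mul0r cos0 sin0.
rewrite exprS ih -natr1 mulrDl mul1r cosD sinD /=.
by apply/eqP; rewrite eq_complex /=; apply/andP; split; apply/eqP; ring.
Qed.

Lemma normsq_sum N (x : nat -> R[i]) :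
  normsq (\sum_(k < N) x k) = \sum_(k < N) \sum_(l < N) complex.Re (x k * (x l)^*).
Proof.
rewrite /normsq rmorph_sum mulr_suml Re_sum; apply: eq_bigr => k _.
by rewrite mulr_sumr Re_sum.
Qed.

(** The square expands into a double sum of exponentials of frequency [k - l], of which only the
    diagonal survives integration. *)
Lemma parseval N (c : nat -> R[i]) :
  integral_is (fun t => normsq (\sum_(k < N) val (expi t) ^+ k * c k))
    (2 * pi * \sum_(k < N) normsq (c k)).
Proof.
have -> : (fun t => normsq (\sum_(k < N) val (expi t) ^+ k * c k)) =
    (fun t => \sum_(k < N) \sum_(l < N)
       complex.Re ((val (expi t) ^+ k * c k) * (val (expi t) ^+ l * c l)^*)).
  by apply/funext => t; rewrite -(normsq_sum N (fun k => val (expi t) ^+ k * c k)).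
(* The null off-diagonal and sine terms are restored, so that both sides become double sums to be
   compared term by term. *)
have -> : 2 * pi * \sum_(k < N) normsq (c k) =
    \sum_(k < N) \sum_(l < N) (complex.Re (c k * (c l)^*) * (2 * pi * (k == l :> nat)%:R)
     + - complex.Im (c k * (c l)^*) * 0).
  rewrite mulr_sumr; apply: eq_bigr => k _; rewrite (bigD1 k) //= big1 ?addr0.
    by rewrite eqxx mulr1 mulr0 addr0 mulrC.
  by move=> l; rewrite eq_sym => /negPf; rewrite -val_eqE /= => ->; rewrite !mulr0 addr0.
pose v (k l : nat) := complex.Re (c k * (c l)^*) * (2 * pi * (k == l)%:R)
     + - complex.Im (c k * (c l)^*) * 0.
apply: (@integral_is_sum N
   (fun k t => \sum_(l < N)
      complex.Re ((val (expi t) ^+ k * c k) * (val (expi t) ^+ l * c l)^*))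
   (fun k => \sum_(l < N) v k l)) => k _.
apply: (@integral_is_sum N
   (fun l t => complex.Re ((val (expi t) ^+ k * c k) * (val (expi t) ^+ l * c l)^*))
   (v k)) => l _.
(* The real part of [c k * (c l)^*] times the exponential of frequency [k - l]. *)
rewrite (_ : (fun t => _) =
  (fun t => complex.Re (c k * (c l)^*) * cos ((k%:R - l%:R) * t)) \+
  (fun t => - complex.Im (c k * (c l)^*) * sin ((k%:R - l%:R) * t))).
  by apply: integral_isD; apply: integral_isZ; [exact: integral_is_cos|exact: integral_is_sin].
apply/funext => t /=; rewrite -!/(val (expi t)) ?expiX mulrBl cosB sinB.
by case: (c k) (c l) => [a b] [p q] /=; ring.
Qed.
End trig.

(** * Fatou's lemma and power series with null radial limits *)

Section radial.
Variable R : realType.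
Local Notation mu := (@lebesgue_measure R).

Lemma integral_is_measurable (g : R -> R) v : integral_is g v ->
  measurable_fun (@angles R : set (measurableTypeR R)) g.
Proof. by move=> [/measurable_int/measurable_EFinP]. Qed.

Lemma ae_imply (P Q : R -> Prop) : (forall t, P t -> Q t) ->
  {ae mu, forall t, P t} -> {ae mu, forall t, Q t}.
Proof. by move=> PQ; apply: filterS => //; exact: (ae_filter_ringOfSetsType mu). Qed.

(** Almost everywhere [h] is the lower limit of the [g n], so Fatou's lemma applies. The bounds may
    vary with [n], only their limit being retained. *)
Lemma fatou_bound (g : nat -> R -> R) (h : R -> R) (B : nat -> R) (b : R) :
  (forall n, measurable_fun (@angles R : set (measurableTypeR R)) (g n)) ->
  measurable_fun (@angles R : set (measurableTypeR R)) h ->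
  (forall n t, 0 <= g n t) -> (forall t, 0 <= h t) ->
  {ae mu, forall t, angles t -> g n t @[n --> \oo] --> h t} ->
  (forall n, \int[mu]_(t in @angles R) (g n t)%:E <= (B n)%:E)%E ->
  B n @[n --> \oo] --> b ->
  (\int[mu]_(t in @angles R) (h t)%:E <= b%:E)%E.
Proof.
move=> mg mh g0 h0 gh gB Bb.
have mg' n : measurable_fun (@angles R : set (measurableTypeR R)) (EFin \o g n).
  by apply/measurable_EFinP; exact: mg.
apply: (@le_trans _ _ (\int[mu]_(t in @angles R) limn_einf (fun n => (g n t)%:E))%E).
  apply: ae_ge0_le_integral.
  - exact: measurable_angles.
  - by move=> t _; rewrite lee_fin.
  - exact/measurable_EFinP.
  - move=> t _; rewrite limn_einf_lim.
    apply: lime_ge; first exact: is_cvg_einfs.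
    apply: nearW => n; apply: le_ereal_inf_tmp => _ [k _ <-].
    by rewrite lee_fin.
  - rewrite /limn_einf; apply: measurableT_comp => //.
    apply: measurable_fun_limn_esup => n.
    by apply: measurableT_comp => //; exact: mg'.
  - move: gh; apply: ae_imply => t ght /ght gt.
    have [-> _] // : (limn_einf (fun n => (g n t)%:E) = (h t)%:E) *
      (limn_esup (fun n => (g n t)%:E) = (h t)%:E).
    by apply: cvg_limn_einf_sup; apply: cvg_EFin => //; exact: nearW.
have /(fatou mu (@measurable_angles R) mg') :
    forall n t, @angles R t -> (0 <= (EFin \o g n) t)%E.
  by move=> n t _; rewrite lee_fin.
move=> /le_trans; apply.
have -> : b%:E = limn (EFin \o B).
  by apply/esym/cvg_lim => //; apply: cvg_EFin => //; exact: nearW.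
rewrite limn_einf_lim; apply: lee_lim.
- exact: is_cvg_einfs.
- by apply/cvg_ex; exists b%:E; apply: cvg_EFin => //; exact: nearW.
(* The infimum over the indices from [n] on is at most the term at [n] itself. *)
apply: nearW => n; apply: le_trans (gB n).
by apply: ereal_inf_lbound; exists n => /=.
Qed.

Lemma val_radial (r : R) (z : circle R) : 0 <= r < 1 ->
  val (radial r z) = r%:C * val z.
Proof.
move=> /andP[r0 r1]; rewrite /radial insubdK//.
by change (`|r%:C * val z| < 1); rewrite normrM (eqP (valP z)) mulr1 ger0_norm ?ler0c// ltcR.
Qed.

Lemma normsqM (x y : R[i]) : normsq (x * y) = normsq x * normsq y.
Proof. by case: x y => [a b] [c d]; rewrite !normsqE /=; ring. Qed.

Lemma normsq_real (r : R) : normsq r%:C = r ^+ 2.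
Proof. by rewrite normsqE /= [0 ^+ 2]expr0n addr0. Qed.

Lemma cvg_sum0 N (u : nat -> nat -> R) : (forall k, u k @ \oo --> 0) ->
  \sum_(k < N) u k j @[j --> \oo] --> 0.
Proof.
move=> u0; elim: N => [|N ih].
  by under eq_fun do rewrite big_ord0; exact: cvg_cst.
under eq_fun do rewrite big_ord_recr /=.
have h : (fun j => \sum_(k < N) u k j + u N j) @ \oo --> (0 + 0 : R) by exact: cvgD.
by rewrite addr0 in h.
Qed.

Section radial_limit.
Variables (a : nat -> R[i]) (f : disc R -> R[i]).
Hypothesis a_sum : cvgn (series (fun k => normsq (a k))).
Hypothesis fE : forall z, series (fun k => val z ^+ k * a k) @ \oo --> f z.

Let p N t := \sum_(k < N) val (expi t) ^+ k * a k.
Let S := limn (series (fun k => normsq (a k))).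

Let seriesS N : series (fun k => normsq (a k)) N <= S.
Proof.
apply: nondecreasing_cvgn_le => //.
by apply: nondecreasing_series => k _ _; exact: normsq_ge0.
Qed.

(* The sum on the right bounds the integral of [|p - P_s|^2], where [P_s] is a
   partial sum of order at least [N0] of the dilation of [f] by [s]; Fatou's
   lemma carries the bound over to the dilation itself. *)
Let radial_L2_bound (s : R) N0 : 0 <= s < 1 ->
  measurable_fun (@angles R : set (measurableTypeR R))
    (fun t => normsq (p N0 t - f (radial s (expi t)))) /\
  (\int[mu]_(t in @angles R) (normsq (p N0 t - f (radial s (expi t))))%:E <=
   (2 * pi * (\sum_(k < N0) normsq (a k) * (1 - s ^+ k) ^+ 2 +
              (S - series (fun k => normsq (a k)) N0)))%:E)%E.
Proof.
move=> s01.
(* The coefficients of [p N0] minus a dilated partial sum: the factor is [1 - s ^+ k] below [N0] and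
   [- s ^+ k] from [N0] on. *)
pose c k : R[i] := ((k < N0)%:R - s ^+ k)%:C * a k.
pose g N t := normsq (\sum_(k < N0 + N) val (expi t) ^+ k * c k).
have gE N t : g N t = normsq (p N0 t -
    series (fun k => val (radial s (expi t)) ^+ k * a k) (N + N0)%N).
  congr normsq; rewrite /p [(N + N0)%N]addnC /series /= big_mkord !big_split_ord /=.
  rewrite opprD addrA -sumrB -sumrN val_radial//; congr (_ + _).
    apply: eq_bigr => k _; rewrite /c ltn_ord exprMn -rmorphXn rmorphB rmorph1.
    by ring.
  apply: eq_bigr => k _.
  by rewrite /c ltnNge leq_addr /= exprMn -rmorphXn sub0r rmorphN; ring.
have gcvg t : g N t @[N --> \oo] --> normsq (p N0 t - f (radial s (expi t))).
  under eq_fun do rewrite gE.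
  apply: normsq_sub_cvg; rewrite (cvg_shiftn N0 (series _)); exact: fE.
have mg N : measurable_fun (@angles R : set (measurableTypeR R)) (g N).
  exact: integral_is_measurable (parseval _ _).
have mf : measurable_fun (@angles R : set (measurableTypeR R))
    (fun t => normsq (p N0 t - f (radial s (expi t)))).
  by apply: measurable_fun_cvg mg _ => t _; exact: gcvg.
split => //.
apply: (@fatou_bound g _ (fun=> 2 * pi * (\sum_(k < N0) normsq (a k) * (1 - s ^+ k) ^+ 2 +
              (S - series (fun k => normsq (a k)) N0)))) => //.
- by move=> n t; exact: normsq_ge0.
- by move=> t; exact: normsq_ge0.
- by apply: aeW => t _; exact: gcvg.
- move=> N; rewrite (parseval _ _).2 lee_fin ler_wpM2l ?mulr_ge0 ?pi_ge0//.
  have /andP[s0 s1] := s01.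
  rewrite big_split_ord /=; apply: lerD.
    by apply: ler_sum => k _; rewrite /c normsqM normsq_real ltn_ord mulrC.
  (* As [s] is at most 1, the terms from [N0] on are dominated by [normsq (a k)], and their sum by
     the tail of [S]. *)
  rewrite lerBrDl; apply: le_trans (seriesS (N0 + N)).
  rewrite /series /= !big_mkord big_split_ord /= lerD2l; apply: ler_sum => k _.
  rewrite /c ltnNge leq_addr normsqM normsq_real sub0r sqrrN ler_piMl ?normsq_ge0//.
  by rewrite -exprM exprn_ile1// ltW.
- exact: cvg_cst.
Qed.

(** A second use of Fatou's lemma, now along radii tending to 1, bounds each partial sum of the
    [normsq (a k)] by the corresponding tail. *)
Lemma radial_limit0_coef : circle_ae (fun z => f (radial r z) @[r --> 1^'-] --> 0) ->
  forall k, a k = 0.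
Proof.
move=> f0.
(* Fatou's lemma concerns sequences, so the limit at 1 is taken along these radii, the first of
   which is 0. *)
pose s (j : nat) : R := 1 - j.+1%:R^-1.
have s01 j : 0 <= s j < 1.
  by rewrite subr_ge0 invf_le1 ?ltr0n// ler1n /= ltrBlDr ltrDl invr_gt0.
have s1 : s @ \oo --> (1 : R).
  rewrite -[X in _ --> X]subr0; apply: cvgB; first exact: cvg_cst.
  exact: cvg_harmonic.
(* Every [s j] is strictly below 1, so the convergence is from the left, as in the hypothesis on
   radial limits. *)
have s1l : s @ \oo --> (1 : R)^'-.
  move=> A /s1 sA; apply: (@filterS _ \oo _ [set j | s j < 1 -> A (s j)] _ _ sA) => j.
  by apply; have /andP[] := s01 j.
have half N0 : series (fun k => normsq (a k)) N0 <= S - series (fun k => normsq (a k)) N0.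
  have pi0 : 0 < 2 * pi :> R by rewrite mulr_gt0// pi_gt0.
  rewrite -(ler_pM2l pi0) -lee_fin /series /= big_mkord -(parseval _ _).2.
  pose B j := (2 * pi * (\sum_(k < N0) normsq (a k) * (1 - s j ^+ k) ^+ 2 +
              (S - \sum_(k < N0) normsq (a k)))).
  apply: (@fatou_bound (fun j t => normsq (p N0 t - f (radial (s j) (expi t)))) _ B).
  - by move=> j; exact: (radial_L2_bound N0 (s01 j)).1.
  - exact: integral_is_measurable (parseval _ _).
  - by move=> j t; exact: normsq_ge0.
  - by move=> t; exact: normsq_ge0.
  - move: f0; apply: ae_imply => t ft /ft {}ft.
    rewrite -[X in normsq X]subr0; apply: normsq_sub_cvg.
    exact: (@cvg_comp _ _ _ s (fun r => f (radial r (expi t))) _ _ _ s1l ft).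
  - move=> j; have := (radial_L2_bound N0 (s01 j)).2.
    by rewrite /series /= big_mkord.
  (* For fixed [N0] finitely many factors [1 - s j ^+ k] occur and each tends to 0; only the tail of
     [S] remains in the limit. *)
  - suff D0 : (fun j => \sum_(k < N0) normsq (a k) * (1 - s j ^+ k) ^+ 2) @ \oo --> (0 : R).
      rewrite -[X in _ --> 2 * pi * X]add0r.
      by apply: cvgM; [exact: cvg_cst|apply: (cvgD D0); exact: cvg_cst].
    apply: (@cvg_sum0 N0 (fun k j => normsq (a k) * (1 - s j ^+ k) ^+ 2)) => k.
    have sk : s j ^+ k @[j --> \oo] --> (1 : R).
      rewrite -[X in _ --> X](expr1n _ k).
      by apply: (@cvg_comp _ _ _ s (fun x => x ^+ k) _ _ _ s1); exact: exprn_continuous.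
    rewrite -[X in _ --> X](mulr0 (normsq (a k))); apply: cvgM; first exact: cvg_cst.
    rewrite -[X in _ --> X](mulr0 (1 - 1)); under eq_fun do rewrite expr2.
    apply: cvgM; first by apply: cvgB => //; exact: cvg_cst.
    by rewrite -[X in _ --> X](subrr 1); apply: cvgB => //; exact: cvg_cst.
have S0 : S <= 0.
  (* By [half], twice every partial sum is at most [S]; the limit in [N] gives this inequality. *)
  suff : S <= S / 2 by lra.
  apply: (@limr_le _ _ _ _ _ (series (fun k => normsq (a k)))); first exact: a_sum.
  apply: nearW => N.
  by have := half N; lra.
move=> k; apply: normsq_eq0; apply/eqP; rewrite eq_le normsq_ge0 andbT.
apply: le_trans S0; apply: le_trans (seriesS k.+1).
rewrite /series /= big_nat_recr//= lerDr sumr_ge0// => i _; exact: normsq_ge0.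
Qed.
End radial_limit.
End radial.

(** * Uniqueness and linearity of Taylor coefficients *)

Section coefficients.
Variables (R : realType) (m : nat).
Implicit Types (F G H : hardy R m).

(* The coefficients [c_k / 2^k] of [f(z / 2)] are square summable, so that
   [radial_limit0_coef] applies to them. *)
Lemma powser_unique (c : nat -> R[i]) :
  (forall z : disc R, series (fun k => val z ^+ k * c k) @ \oo --> (0 : R[i])) ->
  forall k, c k = 0.
Proof.
move=> c0.
have disc_real (r : R) : 0 <= r < 1 -> `|r%:C| < 1.
  by move=> /andP[r0 r1]; rewrite ger0_norm ?ler0c// ltcR.
pose a k : R[i] := (2^-1 ^+ k)%:C * c k.
suff a0 : forall k, a k = 0.
  move=> k; have /eqP := a0 k; rewrite mulf_eq0 => /orP[|/eqP //].
  by rewrite (inj_eq (@complexI R) _ 0) expf_eq0 invr_eq0 pnatr_eq0 andbF.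
(* Any radius strictly between 1/2 and 1 would do: the terms at 3/4 are bounded, and the halved
   coefficients then have squares dominated by a geometric series of ratio
   [(1/2)^2 / (3/4)^2 = 4/9]. *)
have z0P : `|(3 / 4 : R)%:C| < 1 by apply: disc_real; lra.
have := c0 (exist _ (3 / 4)%:C z0P : disc R).
move=> /cvgP /cvg_series_cvg_0 t0; 
have v0 : cvgn (fun k => normsq (0 - (3 / 4)%:C ^+ k * c k)).
  by apply: cvgP; apply: normsq_sub_cvg t0.
have [M [_ /(_ (M + 1))]] := cvg_seq_bounded v0.
rewrite ltrDl ltr01 => /(_ isT) vM.
apply: (@radial_limit0_coef _ a (fun=> 0)).
- apply: (@series_le_cvg _ _ (geometric (M + 1) (4 / 9))).
  + by move=> k; exact: normsq_ge0.
  + move=> k; apply: mulr_ge0; last by apply: exprn_ge0; lra.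
    by apply: le_trans (vM k I); exact: normr_ge0.
  + move=> k; have := vM k I; rewrite /= sub0r -mulNr normsqM.
    rewrite -rmorphXn -rmorphN normsq_real sqrrN ger0_norm ?mulr_ge0 ?sqr_ge0 ?normsq_ge0//.
    move=> h; rewrite /a normsqM normsq_real.
    have -> : (2^-1 ^+ k : R) ^+ 2 = ((3 / 4) ^+ k) ^+ 2 * (4 / 9) ^+ k.
      rewrite -!exprM ![(k * 2)%N]mulnC !exprM -exprMn; congr (_ ^+ k).
      by field.
    by rewrite mulrAC ler_wpM2r ?exprn_ge0//; lra.
  + by apply: is_cvg_geometric_series; rewrite ger0_norm; lra.
- move=> z.
  have zP : `|2^-1%:C * val z| < 1.
    rewrite normrM; apply: le_lt_trans (valP z).
    by rewrite ler_piMl// ltW// disc_real//; lra.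
  rewrite (_ : series _ = series (fun k => (2^-1%:C * val z) ^+ k * c k)).
    exact: c0 (exist _ (2^-1%:C * val z) zP : disc R).
  congr series; apply/funext => k; rewrite /a exprMn rmorphXn.
  by ring.
- by apply: aeW => t _; exact: cvg_cst.
Qed.

Lemma has_expansion_lin (a : R[i]) (F G : disc R -> 'cV[R[i]]_m) A B :
  has_expansion F A -> has_expansion G B ->
  has_expansion (a *: F + G) (fun k => a *: A k + B k).
Proof.
move=> FA GB z i.
have -> : series (fun k => val z ^+ k * (a *: A k + B k) i 0) =
    (fun n => a * series (fun k => val z ^+ k * A k i 0) n
      + series (fun k => val z ^+ k * B k i 0) n).
  apply/funext => n; rewrite /series/= mulr_sumr -big_split/=.
  by apply: eq_bigr => k _; rewrite !mxE mulrDr mulrCA.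
have -> : (a *: F + G) z i 0 = a * F z i 0 + G z i 0 by rewrite !mxE.
by apply: cvgD (GB z i); apply: cvgM (cvg_cst a) (FA z i).
Qed.

(** The coefficientwise difference [B - A] expands the zero function, so [powser_unique] applies in
    each component. *)
Lemma has_expansion_unique (F : disc R -> 'cV[R[i]]_m) A B :
  has_expansion F A -> has_expansion F B -> A = B.
Proof.
move=> FA FB; apply/funext => k; apply/matrixP => i j; rewrite ord1.
apply/eqP; rewrite eq_sym -subr_eq0; apply/eqP.
apply: (powser_unique (c := fun k => B k i 0 - A k i 0)) => z.
have : has_expansion (-1 *: F + F) _ := has_expansion_lin FA FB.
move=> /(_ z i).
have -> : (-1 *: F + F) z i 0 = 0 by rewrite !mxE mulN1r addNr.
rewrite (_ : (fun k => val z ^+ k * (-1 *: A k + B k) i 0) =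
  (fun k => val z ^+ k * (B k i 0 - A k i 0)))//.
by apply/funext => n; rewrite !mxE mulN1r addrC.
Qed.

(** [hardy_coef] is selected by the expansion alone; uniqueness identifies it with the square
    summable witness of membership in the Hardy space. *)
Lemma hardy_coefP F : has_expansion F (hardy_coef F) /\ sqsummable (hardy_coef F).
Proof.
case: F => F Fp; have /asboolP[A [sA FA]] := Fp.
have /= := @xgetPex _ (fun=> 0) [set A | has_expansion F A] (ex_intro _ A FA).
rewrite /hardy_coef /= => h; split => //.
by rewrite (has_expansion_unique h FA).
Qed.

Lemma hardy_coef_lin (a : R[i]) F G :
  hardy_coef (a *: F + G) = fun k => a *: hardy_coef F k + hardy_coef G k.
Proof.
apply: has_expansion_unique (hardy_coefP _).1 _.
exact: (has_expansion_lin (a := a) (hardy_coefP F).1 (hardy_coefP G).1).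
Qed.

Lemma hardy_eq0 F : (forall k, hardy_coef F k = 0) -> F = 0.
Proof.
move=> F0; apply: val_inj; apply/funext => z; apply/matrixP => i j; rewrite ord1.
rewrite mxE; have := (hardy_coefP F).1 z i.
rewrite (_ : series _ = fun=> 0); last first.
  by apply/funext => n; rewrite /series /= big1// => k _; rewrite F0 mxE mulr0.
by move=> h; apply: (cvg_unique _ h (cvg_cst _)); exact: norm_hausdorff.
Qed.
End coefficients.

(** * The inner product of the Hardy space *)

Section inner_product.
Variables (R : realType) (m : nat).
Implicit Types (F G H : hardy R m) (u v : 'cV[R[i]]_m).

Lemma vdotE u v :
  complex.Re (vdot u v) = \sum_i (complex.Re (u i 0) * complex.Re (v i 0) +
                                  complex.Im (u i 0) * complex.Im (v i 0)) /\
  complex.Im (vdot u v) = \sum_i (complex.Im (u i 0) * complex.Re (v i 0) -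
                                  complex.Re (u i 0) * complex.Im (v i 0)).
Proof.
rewrite /vdot Re_sum Im_sum; split; apply: eq_bigr => i _;
  by case: (u i 0) (v i 0) => [? ?] [? ?] /=; ring.
Qed.

(** Young's inequality in each component, without the factor 1/2. It provides a summable majorant
    for the series defining [hdot]. *)
Lemma vdot_bound u v :
  `|complex.Re (vdot u v)| <= vnormsq u + vnormsq v /\
  `|complex.Im (vdot u v)| <= vnormsq u + vnormsq v.
Proof.
have key (a b c d : R) : `|a * c + b * d| <= a ^+ 2 + b ^+ 2 + (c ^+ 2 + d ^+ 2).
  have := (sqr_ge0 (a + c), sqr_ge0 (a - c), sqr_ge0 (b + d), sqr_ge0 (b - d)).
  have := (sqr_ge0 a, sqr_ge0 b, sqr_ge0 c, sqr_ge0 d) => -[[[ha hb] hc] hd].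
  rewrite !sqrrD !sqrrN !mulrN !mulr2n => -[[[h1 h2] h3] h4].
  by rewrite ler_norml; apply/andP; split; lra.
have [-> ->] := vdotE u v; rewrite !vnormsqE -big_split.
split; apply: le_trans (ler_norm_sum _ _ _) _; apply: ler_sum => i _;
  rewrite -!/(normsq _) !normsqE; first exact: key.
(* The imaginary part has the form treated by [key], with [Im u] and [- Re u] in place of [Re u] and
   [Im u]. *)
by rewrite -mulNr [X in _ <= X + _]addrC -(sqrrN (complex.Re (u i 0))) key.
Qed.

(** Real and imaginary parts converge absolutely by [vdot_bound]. This makes the [limn] in [hdot] a
    genuine limit, to which the algebra of limits applies. *)
Lemma hdot_cvg F G :
  series (fun k => vdot (hardy_coef F k) (hardy_coef G k)) @ \oo --> hdot F G.
Proof.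
set w := fun k => _.
have bound (h : R[i] -> R) : (forall k, `|h (w k)| <=
    vnormsq (hardy_coef F k) + vnormsq (hardy_coef G k)) -> cvgn (series (h \o w)).
  move=> hw; apply: normed_cvg; apply: series_le_cvg hw _.
  - by move=> k; exact: normr_ge0.
  - by move=> k; rewrite addr_ge0 ?vnormsq_ge0.
  - by apply: is_cvg_seriesD; [exact: (hardy_coefP F).2|exact: (hardy_coefP G).2].
have /cvg_ex[x wx] := bound (@complex.Re R) (fun k => (vdot_bound _ _).1).
have /cvg_ex[y wy] := bound (@complex.Im R) (fun k => (vdot_bound _ _).2).
have : series w @ \oo --> x +i* y.
  apply/cvg_complexP; split.
    by under eq_fun do rewrite /series /= Re_sum.
  by under eq_fun do rewrite /series /= Im_sum.
by move=> h; rewrite /hdot (cvg_lim _ h).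
Qed.

Lemma vdot_lin (a : R[i]) u v w : vdot (a *: u + v) w = a * vdot u w + vdot v w.
Proof.
rewrite /vdot mulr_sumr -big_split; apply: eq_bigr => i _.
by rewrite !mxE mulrDl mulrA.
Qed.

Lemma hdot_lin (a : R[i]) F G H : hdot (a *: F + G) H = a * hdot F H + hdot G H.
Proof.
rewrite {1}/hdot; apply: cvg_lim => //.
rewrite hardy_coef_lin.
rewrite (_ : series _ = fun n =>
    a * series (fun k => vdot (hardy_coef F k) (hardy_coef H k)) n +
    series (fun k => vdot (hardy_coef G k) (hardy_coef H k)) n).
  apply: cvgD; last exact: hdot_cvg.
  by apply: cvgM; [exact: cvg_cst|exact: hdot_cvg].
apply/funext => n; rewrite /series /= mulr_sumr -big_split.
by apply: eq_bigr => k _; exact: vdot_lin.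
Qed.

Lemma vdotC u v : vdot v u = (vdot u v)^*.
Proof.
rewrite /vdot rmorph_sum; apply: eq_bigr => i _.
by rewrite rmorphM /= conjcK mulrC.
Qed.

Lemma hdotC F G : hdot G F = (hdot F G)^*.
Proof.
rewrite {1}/hdot; apply: cvg_lim => //.
have /cvg_complexP[cr ci] := @hdot_cvg F G.
rewrite (_ : series _ = fun n =>
    (series (fun k => vdot (hardy_coef F k) (hardy_coef G k)) n)^*); last first.
  apply/funext => n; rewrite /series /= rmorph_sum.
  by apply: eq_bigr => k _; exact: vdotC.
have ReJ (x : R[i]) : complex.Re x^* = complex.Re x by case: x.
have ImJ (x : R[i]) : complex.Im x^* = - complex.Im x by case: x.
apply/cvg_complexP; rewrite ReJ ImJ; split.
  by under eq_fun do rewrite ReJ.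
by under eq_fun do rewrite ImJ; exact: cvgN.
Qed.

(** One term of a series of nonnegative terms is at most its sum. Positivity and definiteness of
    [hdot] follow. *)
Lemma vnormsq_le_hdot F k : vnormsq (hardy_coef F k) <= complex.Re (hdot F F).
Proof.
have /cvg_complexP[+ _] := @hdot_cvg F F.
rewrite (_ : (fun t => _) = series (fun k => vnormsq (hardy_coef F k))); last first.
  by apply/funext => n; rewrite /series /= Re_sum.
move=> h; rewrite -(cvg_lim _ h)//.
apply: (@le_trans _ _ (series (fun k => vnormsq (hardy_coef F k)) k.+1)).
  rewrite /series /= big_nat_recr//= lerDr sumr_ge0// => i _; exact: vnormsq_ge0.
apply: nondecreasing_cvgn_le; last exact: (cvgP _ h).
by apply: nondecreasing_series => i _ _; exact: vnormsq_ge0.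
Qed.

Lemma hdot_ge0 F : 0 <= complex.Re (hdot F F).
Proof. exact: le_trans (vnormsq_ge0 _) (vnormsq_le_hdot F 0). Qed.

Lemma vnormsq_eq0 u : vnormsq u = 0 -> u = 0.
Proof.
rewrite vnormsqE => /eqP; rewrite psumr_eq0; last by move=> i _; exact: normsq_ge0.
move=> /allP h; apply/matrixP => i j; rewrite ord1 mxE; apply: normsq_eq0.
by apply/eqP/h; rewrite mem_index_enum.
Qed.

Lemma hdot_eq0 F : complex.Re (hdot F F) <= 0 -> F = 0.
Proof.
move=> F0; apply: hardy_eq0 => k; apply: vnormsq_eq0; apply/eqP.
by rewrite eq_le vnormsq_ge0 andbT (le_trans (vnormsq_le_hdot F k)).
Qed.

Lemma hdot_hnorm F (e : R) : 0 < e -> hnorm F < e -> complex.Re (hdot F F) < e ^+ 2.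
Proof.
move=> e0; rewrite /hnorm => Fe.
by rewrite -(sqr_sqrtr (hdot_ge0 F)) ltr_pXn2r// nnegrE ?sqrtr_ge0// ltW.
Qed.
End inner_product.

(** * Vanishing of the Toeplitz operator with null symbol *)

Section toeplitz_null_symbol.
Variables (R : realType) (m : nat).
Local Notation mu := (@lebesgue_measure R).

Lemma ae_imply2 (P Q S : R -> Prop) : (forall t, P t -> Q t -> S t) ->
  {ae mu, forall t, P t} -> {ae mu, forall t, Q t} -> {ae mu, forall t, S t}.
Proof. by move=> PQ; apply: filterS2 => //; exact: (ae_filter_ringOfSetsType mu). Qed.

(** Each component has null radial limits and square summable coefficients, so [radial_limit0_coef]
    applies. *)
Lemma hardy_boundary0 (K : hardy R m) (k : circle R -> 'cV[R[i]]_m) :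
  boundary_values K k -> circle_ae (fun z => k z = 0) -> K = 0.
Proof.
move=> [_ Kk] k0; have [KA sA] := hardy_coefP K.
apply: hardy_eq0 => j; apply/matrixP => i i'; rewrite ord1 mxE.
apply: (radial_limit0_coef (a := fun j => hardy_coef K j i 0)
                           (f := fun z => K z i 0)).
- apply: (series_le_cvg _ _ _ sA) => l; first exact: normsq_ge0.
    exact: vnormsq_ge0.
  rewrite vnormsqE (bigD1 i)//= lerDl sumr_ge0// => l' _; exact: normsq_ge0.
- by move=> z; exact: KA.
- apply: ae_imply2 Kk k0 => t Kt kt ta.
  by have := Kt ta i; rewrite (kt ta) mxE.
Qed.

(** Either [xget] returns boundary values, measurable as members of [L2], or it returns its default,
    the zero function. *)
Lemma circle_measurable_boundary (F : hardy R m) (i : 'I_m) :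
  circle_measurable (fun z => boundary F z i 0).
Proof.
rewrite /boundary; case: xgetP => [y _ [[my _] _]|_]; first exact: my.
by split; under eq_fun do rewrite mxE; exact: measurable_cst.
Qed.

Lemma circle_measurable_mulmx (Phi : circle R -> 'M[R[i]]_m)
    (f : circle R -> 'cV[R[i]]_m) (i : 'I_m) :
  (forall i j, circle_measurable (fun z => Phi z i j)) ->
  (forall i, circle_measurable (fun z => f z i 0)) ->
  circle_measurable (fun z => (Phi z *m f z) i 0).
Proof.
move=> mPhi mf; split.
  rewrite [X in measurable_fun _ X](_ : _ = (fun t => \sum_j
    (complex.Re (Phi (expi t) i j) * complex.Re (f (expi t) j 0) -
     complex.Im (Phi (expi t) i j) * complex.Im (f (expi t) j 0)))); last first.
    apply/funext => t; rewrite mxE Re_sum; apply: eq_bigr => j _.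
    by case: (Phi _ i j) (f _ j 0) => [a b] [c d].
  apply: measurable_sum => j; apply: measurable_funB; apply: measurable_funM.
  - exact: (mPhi i j).1.
  - exact: (mf j).1.
  - exact: (mPhi i j).2.
  - exact: (mf j).2.
rewrite [X in measurable_fun _ X](_ : _ = (fun t => \sum_j
    (complex.Re (Phi (expi t) i j) * complex.Im (f (expi t) j 0) +
     complex.Im (Phi (expi t) i j) * complex.Re (f (expi t) j 0)))); last first.
  apply/funext => t; rewrite mxE Im_sum; apply: eq_bigr => j _.
  by case: (Phi _ i j) (f _ j 0) => [a b] [c d].
apply: measurable_sum => j; apply: measurable_funD; apply: measurable_funM.
- exact: (mPhi i j).1.
- exact: (mf j).2.
- exact: (mPhi i j).2.
- exact: (mf j).1.
Qed.

Lemma circle_measurable_vdot (f g : circle R -> 'cV[R[i]]_m) :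
  (forall i, circle_measurable (fun z => f z i 0)) ->
  (forall i, circle_measurable (fun z => g z i 0)) ->
  measurable_fun (@angles R) (fun t => complex.Re (vdot (f (expi t)) (g (expi t)))).
Proof.
move=> mf mg; under eq_fun do rewrite (vdotE _ _).1.
apply: measurable_sum => j; apply: measurable_funD; apply: measurable_funM.
- exact: (mf j).1.
- exact: (mg j).1.
- exact: (mf j).2.
- exact: (mg j).2.
Qed.

(** If [k] represents the projection, orthogonality of [f - k] to [k] itself reads [- |k|^2 = 0] in
    the mean, since [f] is null; hence [k] is null almost everywhere. *)
Lemma hardy_proj0 (f : circle R -> 'cV[R[i]]_m) :
  (forall i, circle_measurable (fun z => f z i 0)) ->
  circle_ae (fun z => f z = 0) -> hardy_proj f = 0.
Proof.
(* Without a candidate the default of [xget] is already 0; otherwise [K] is tested against its own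
   boundary values. *)
move=> mf f0; rewrite /hardy_proj; case: xgetP => [K _ [k Kk]|//] /(_ K k Kk).
have [[mk k2] _] := Kk.
pose g t := complex.Re (vdot ((f - k) (expi t)) (k (expi t))).
move=> /(congr1 (@complex.Re R)) /= /eqP.
rewrite mulf_eq0 invr_eq0 mulf_eq0 pnatr_eq0 (gt_eqF (pi_gt0 R)) /= => /eqP g0.
have mg : measurable_fun (@angles R) g.
  apply: circle_measurable_vdot => // i; split.
    rewrite [X in measurable_fun _ X](_ : _ = (fun t =>
      complex.Re (f (expi t) i 0) - complex.Re (k (expi t) i 0))); last first.
      by apply/funext => t; rewrite /= !mxE ReB.
    by apply: measurable_funB; [exact: (mf i).1|exact: (mk i).1].
  rewrite [X in measurable_fun _ X](_ : _ = (fun t =>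
    complex.Im (f (expi t) i 0) - complex.Im (k (expi t) i 0))); last first.
    by apply/funext => t; rewrite /= !mxE ImB.
  by apply: measurable_funB; [exact: (mf i).2|exact: (mk i).2].
have mn : measurable_fun (@angles R) (fun t => vnormsq (k (expi t))).
  exact: circle_measurable_vdot.
have gk : (\int[mu]_(t in @angles R) (g t)%:E =
           \int[mu]_(t in @angles R) - (vnormsq (k (expi t)))%:E)%E.
  apply: ae_eq_integral.
  - exact: measurable_angles.
  - exact/measurable_EFinP.
  - by apply: measurableT_comp => //; exact/measurable_EFinP.
  - apply: ae_imply f0 => t ft ta.
    rewrite /g -EFinN; congr EFin.
    have -> : (f - k) (expi t) = - k (expi t).
      by apply/matrixP => i i'; rewrite !mxE (ft ta) !mxE sub0r.
    rewrite (vdotE _ _).1 /vnormsq (vdotE _ _).1 -sumrN; apply: eq_bigr => i _.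
    by rewrite mxE; case: (k _ i 0) => a b /=; ring.
have n0 : (\int[mu]_(t in @angles R) (vnormsq (k (expi t)))%:E = 0)%E.
  have n_ge0 : (0 <= \int[mu]_(t in @angles R) (vnormsq (k (expi t)))%:E)%E.
    by apply: integral_ge0 => t _; rewrite lee_fin vnormsq_ge0.
  move: g0; rewrite /Rintegral gk integral_ge0N; last first.
    by move=> t _; rewrite lee_fin vnormsq_ge0.
  (* [Rintegral] sends infinite values to 0, so its vanishing is informative only once [k2] has
     excluded [+oo] and [n_ge0] has excluded [-oo]. *)
  move: n_ge0 k2; case: (integral _ _ _) => [r||] //= _ _ /eqP.
  by rewrite oppr_eq0 => /eqP ->.
suff -> : K = 0 by [].
apply: (hardy_boundary0 Kk).
have : ae_eq mu (@angles R) (fun t => (vnormsq (k (expi t)))%:E) (cst 0%E).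
  apply/ae_eq_integral_abs.
  - exact: measurable_angles.
  - exact/measurable_EFinP.
  - rewrite -[RHS]n0; apply: eq_integral => t _.
    by rewrite gee0_abs// lee_fin vnormsq_ge0.
apply: ae_imply => t kt ta; apply: vnormsq_eq0.
by have [] := kt ta.
Qed.

Lemma toeplitz0 (Phi : circle R -> 'M[R[i]]_m) (F : hardy R m) :
  Linfty Phi -> circle_ae (fun z => Phi z = 0) -> toeplitz Phi F = 0.
Proof.
move=> [mPhi _] Phi0; apply: hardy_proj0.
  move=> i; apply: circle_measurable_mulmx => // j.
  exact: circle_measurable_boundary.
by apply: ae_imply Phi0 => t Pt ta; rewrite Pt// mul0mx.
Qed.
End toeplitz_null_symbol.

(** * Orthonormal families: projection, Pythagoras and Bessel *)

Section orthonormal.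
Variables (R : realType) (m n : nat).
Implicit Types (F : hardy R m) (G : 'I_n -> hardy R m).

Lemma hdot0 F : hdot 0 F = 0.
Proof.
have := hdot_lin 1 0 0 F; rewrite scaler0 addr0 mul1r => /eqP.
by rewrite -subr_eq subrr eq_sym => /eqP.
Qed.

Lemma hdotD F1 F2 F : hdot (F1 + F2) F = hdot F1 F + hdot F2 F.
Proof. by have := hdot_lin 1 F1 F2 F; rewrite scale1r mul1r. Qed.

Lemma hdotZ (a : R[i]) F1 F : hdot (a *: F1) F = a * hdot F1 F.
Proof. by have := hdot_lin a F1 0 F; rewrite addr0 hdot0 addr0. Qed.

Lemma hdotB F1 F2 F : hdot (F1 - F2) F = hdot F1 F - hdot F2 F.
Proof. by rewrite -[- F2]scaleN1r hdotD hdotZ mulN1r. Qed.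

Lemma hdot_sum (c : 'I_n -> R[i]) G F :
  hdot (\sum_i c i *: G i) F = \sum_i c i * hdot (G i) F.
Proof.
rewrite (big_morph (fun F1 => hdot F1 F) (fun x y => hdotD x y F) (hdot0 F)).
by apply: eq_bigr => i _; rewrite hdotZ.
Qed.

Lemma hdot_sum_orthonormal (c : 'I_n -> R[i]) G j : hardy_orthonormal G ->
  hdot (\sum_i c i *: G i) (G j) = c j.
Proof.
move=> oG; rewrite hdot_sum (bigD1 j)//= big1 ?addr0; first by rewrite oG eqxx mulr1.
by move=> i ij; rewrite oG (negPf ij) mulr0.
Qed.

Definition span_proj G F : hardy R m := \sum_i hdot F (G i) *: G i.

Lemma hdot_span_proj G F j : hardy_orthonormal G ->
  hdot (F - span_proj G F) (G j) = 0.
Proof. by move=> oG; rewrite hdotB hdot_sum_orthonormal// subrr. Qed.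

Lemma hdot_lin_span F G E : (forall i, hdot F (G i) = 0) -> lin_span G E ->
  hdot F E = 0.
Proof.
move=> FG [c ->]; rewrite hdotC hdot_sum big1 ?conjc0// => i _.
by rewrite hdotC FG conjc0 mulr0.
Qed.

Lemma pythagoras F E : hdot F E = 0 ->
  complex.Re (hdot (F + E) (F + E)) = complex.Re (hdot F F) + complex.Re (hdot E E).
Proof.
move=> FE; have EF : hdot E F = 0 by rewrite hdotC FE conjc0.
rewrite hdotD (hdotC (F + E) F) (hdotC (F + E) E) !hdotD FE EF addr0 add0r.
by case: (hdot F F) (hdot E E) => [? ?] [? ?].
Qed.

(** Pythagoras for the splitting of [F] along [G j]. It makes the coefficient against [G j]
    continuous in [F], whence the closedness of the kernel. *)
Lemma bessel G F j : hardy_orthonormal G ->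
  normsq (hdot F (G j)) <= complex.Re (hdot F F).
Proof.
move=> oG; pose c := hdot F (G j).
have ho : hdot (F - c *: G j) (c *: G j) = 0.
  by rewrite hdotC hdotZ hdotC hdotB hdotZ oG eqxx mulr1 subrr conjc0 mulr0 conjc0.
have := pythagoras ho; rewrite subrK => ->.
rewrite hdotZ (hdotC (c *: G j) (G j)) hdotZ oG eqxx mulr1 lerDr; exact: hdot_ge0.
Qed.
End orthonormal.

(** * The kernel as an orthogonal complement, and its defect space *)

Theorem theorem2p1 (R : realType) (m n : nat) (hm : (1 <= m)%N) (hn : (1 <= n)%N)
    (Phi : circle R -> 'M[R[i]]_m) (Phi_Linfty : Linfty Phi)
    (G H : 'I_n -> hardy R m)
    (G_orthonormal : hardy_orthonormal G) (H_orthonormal : hardy_orthonormal H)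
    (Phi0 : circle_ae (fun z => Phi z = 0)) :
  nearly_invariant_with_defect (kernel_of (perturbed_toeplitz Phi G H)) n /\
  defect_space (kernel_of (perturbed_toeplitz Phi G H)) n (closed_span G).
Proof.
set M := kernel_of _.
have ME F : M F <-> forall i, hdot F (G i) = 0.
  rewrite /M /kernel_of /perturbed_toeplitz /= toeplitz0// add0r; split.
    (* Pairing the null sum with [H i] isolates its coefficient. *)
    move=> h i; have := hdot_sum_orthonormal (fun i => hdot F (G i)) i H_orthonormal.
    by rewrite h hdot0 => <-.
  by move=> h; rewrite big1// => i _; rewrite h scale0r.
(* The choice [e = sqrt x] would give [x < x] for a positive [x]. *)
have small (x : R) : 0 <= x -> (forall e, 0 < e -> x < e ^+ 2) -> x = 0.
  move=> x0 xe; apply/eqP; rewrite eq_le x0 andbT leNgt; apply/negP => xp.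
  have := xe (Num.sqrt x); rewrite sqrtr_gt0 => /(_ xp).
  by rewrite sqr_sqrtr// ltxx.
(* The finite span is already closed: [span_proj G F] is its nearest point to [F], so arbitrarily
   close points of the span force [F] to equal it. *)
have spanE : closed_span G = lin_span G.
  apply/seteqP; split => F.
    move=> FG; exists (fun i => hdot F (G i)); apply/eqP; rewrite -subr_eq0; apply/eqP.
    apply: hdot_eq0.
    suff -> : complex.Re (hdot (F - span_proj G F) (F - span_proj G F)) = 0 by [].
    apply: small => [|e e0]; first exact: hdot_ge0.
    have [E [c Ec] /(hdot_hnorm e0)] := FG e e0.
    apply: le_lt_trans.
    have -> : F - E = (F - span_proj G F) + (span_proj G F - E) by rewrite addrA subrK.
    rewrite [leRHS]pythagoras; first by rewrite lerDl hdot_ge0.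
    apply: (@hdot_lin_span _ _ _ _ G) => [i|]; first exact: hdot_span_proj.
    exists (fun i => hdot F (G i) - c i); rewrite Ec -sumrB.
    by apply: eq_bigr => i _; rewrite scalerBl.
  move=> FG e e0; exists F => //; rewrite subrr /hnorm hdot0 /= sqrtr0//.
have defect : defect_space M n (closed_span G).
  rewrite spanE; split.
  - exists G => // c c0 i.
    by have := hdot_sum_orthonormal c i G_orthonormal; rewrite c0 hdot0 => <-.
  - by move=> F E /ME MF; exact: hdot_lin_span.
  - move=> F _ _; set K := backward_shift F.
    exists (K - span_proj G K), (span_proj G K); split.
    + by apply/ME => i; exact: hdot_span_proj.
    + by exists (fun i => hdot K (G i)).
    + by rewrite subrK.
split; last exact: defect.
split; last by exists (closed_span G).
  split; first by apply/ME => i; exact: hdot0.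
  by move=> a F E /ME FG /ME EG; apply/ME => i; rewrite hdot_lin FG EG mulr0 addr0.
(* A nearby [E] in the kernel is orthogonal to [G i], so Bessel's inequality for [F - E] bounds the
   coefficient of [F] itself. *)
move=> F FM; apply/ME => i; apply: normsq_eq0.
apply: small => [|e e0]; first exact: normsq_ge0.
have [E /ME EG /(hdot_hnorm e0)] := FM e e0.
apply: le_lt_trans; apply: le_trans (bessel (F - E) i G_orthonormal).
by rewrite hdotB EG subr0.
Qed.
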